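(* Let $X_1,X_2,\ldots$ be a weakly stationary sequence in a Hilbert space $H$, let $S_n=X_1+\cdots+X_n$, and for $n\ge1$ let $f(n)\ge 0$ be defined by $$f^2(n)=\sup_{1\le n'\le n}\frac{\|S_{n'}\|^2}{n'}.$$ For positive integers $x,y$ put $$\mathrm I(f,x,y)=\frac{f^2(x+y)-f^2(x)+f^2(y)}{2f(x+y)f(y)}.$$ Then for any positive integers $x,y$ such that $f^2(x)/x\ge f^2(y)/y$, one has $$\mathrm I(f,x,y)\le 2\sqrt{\frac{y}{y+x}}.$$
   Context: A sequence $X_1,X_2,\ldots$ in a Hilbert space $H$ is weakly stationary if $\langle X_{i+k},X_{j+k}\rangle=\langle X_i,X_j\rangle$ for all $i,j\ge1$ and $k\ge 0$. Here $f^2(n)$ means $(f(n))^2$. The sequence is understood to be nonzero ($X_1\ne0$), so that $f(n)>0$ for all $n\ge 1$ and $\mathrm I(f,x,y)$ is defined. *)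

(* Defs.v *)
From HB Require Import structures.
From mathcomp Require Import all_boot all_order all_algebra.
From mathcomp Require Import sesquilinear complex.
From mathcomp Require Import boolp classical_sets reals topology normedtype.

Set Implicit Arguments.
Unset Strict Implicit.
Unset Printing Implicit Defensive.

Import Order.TTheory GRing.Theory Num.Theory.
Import numFieldNormedType.Exports.

Local Open Scope classical_set_scope.
Local Open Scope ring_scope.

(* Real Hilbert spaces are obtained with K := R and theta := idfun, complex
   ones with K := R[i] and theta := Num.conj.  The inner product is linear in its
   first argument and theta-linear in its second one, and the K-valued norm is
   the one it induces. *)
HB.mixin Record NormedModule_isHilbert (K : numFieldType) (theta : K -> K) H
    & CompleteNormedModule K H := {
  inner : {dot H for theta} ;
  sqr_norm_inner : forall u : H, `|u| ^+ 2 = inner u u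
}.

#[short(type="hilbertType")]
HB.structure Definition Hilbert (K : numFieldType) (theta : K -> K) :=
  { H of CompleteNormedModule K H & NormedModule_isHilbert K theta H }.

(* Sequences X_1, X_2, ... are functions on nat whose value at 0 is ignored. *)
Definition weakly_stationary (K : numFieldType) (theta : K -> K)
    (H : hilbertType theta) (X : nat -> H) : Prop :=
  forall i j k : nat, (0 < i)%N -> (0 < j)%N ->
    inner (X (i + k)%N) (X (j + k)%N) = inner (X i) (X j).

Definition psum (V : zmodType) (X : nat -> V) (n : nat) : V :=
  \sum_(1 <= i < n.+1) X i.

(* N n stands for the real number |S_n|. *)
Definition mean_sq (R : realType) (N : nat -> R) (n : nat) : set R :=
  [set N m ^+ 2 / m%:R | m in [set m : nat | (1 <= m <= n)%N]].

Definition fsup (R : realType) (N : nat -> R) (n : nat) : R :=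
  Num.sqrt (sup (mean_sq N n)).

Lemma fsup_ge0 (R : realType) (N : nat -> R) (n : nat) : 0 <= fsup N n.
Proof. exact: sqrtr_ge0. Qed.

Lemma sqr_fsup (R : realType) (N : nat -> R) (n : nat) :
  fsup N n ^+ 2 = sup (mean_sq N n).
Proof.
rewrite sqr_sqrtr//.
have [[[z Nz] ubN]|/sup_out->//] := pselect (has_sup (mean_sq N n)).
apply: le_trans (ub_le_sup ubN Nz); case: Nz => m _ <-.
by rewrite divr_ge0 ?sqr_ge0.
Qed.

Definition Ifun (R : realType) (f : nat -> R) (x y : nat) : R :=
  (f (x + y)%N ^+ 2 - f x ^+ 2 + f y ^+ 2) / (2 * f (x + y)%N * f y).

(* Main.v *)
(* By stationarity |S_(n+k) - S_k| = |S_n|, so N n = |S_n| is subadditive.  Let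
   a = f x, b = f y, G = f (x+y), s = sqrt (y / (x+y)).  If G is attained at
   x + m with 1 <= m <= y, then
   (x+m) G^2 <= (sqrt x a + sqrt m b)^2 and sqrt (x m) <= (x+m) s give
   G^2 <= max(a,b)^2 + 2 s a b; if it is attained at or below x, then G = a.
   For y <= x this reads G^2 - a^2 <= 2 s a b, and the hypothesis gives
   b^2 <= 2 s^2 G^2.  For x <= y it gives b <= G <= 2 b while s^2 >= 1/2. *)
Require Import Defs.
From mathcomp Require Import all_boot all_order all_algebra.
From mathcomp Require Import sesquilinear complex.
From mathcomp Require Import boolp classical_sets reals topology normedtype.
From mathcomp Require Import zify ring lra.

Set Implicit Arguments.
Unset Strict Implicit.

Import Order.TTheory GRing.Theory Num.Theory.
Local Open Scope ring_scope.

Section Fsup.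
Variables (R : realType) (N : nat -> R).
Implicit Types m n : nat.

Lemma mean_sq_bounded n : has_ubound (mean_sq N n).
Proof.
(* The sum of all the nonnegative terms is a crude bound; its extra term at 0 vanishes, division by
   0 being 0. *)
exists (\sum_(i < n.+1) N i ^+ 2 / i%:R) => _ [m /= /andP[_ mn] <-].
rewrite (bigD1 (Ordinal (mn : (m < n.+1)%N))) //= lerDl sumr_ge0 // => i _.
by rewrite divr_ge0 ?sqr_ge0.
Qed.

Lemma mean_sq_le_sqr_fsup m n :
  (0 < m <= n)%N -> N m ^+ 2 / m%:R <= fsup N n ^+ 2.
Proof.
move=> mn; rewrite sqr_fsup; apply: (ub_le_sup (mean_sq_bounded n)).
by exists m.
Qed.

Lemma fsup_attained n : (0 < n)%N ->
  exists2 m, (0 < m <= n)%N & fsup N n ^+ 2 = N m ^+ 2 / m%:R.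
Proof.
case: n => // n _.
case: (@arg_maxP _ R 'I_n.+1 ord0 xpredT (fun i => N i.+1 ^+ 2 / i.+1%:R)) => //.
move=> i _ imax; exists i.+1; first exact: ltn_ord.
apply/eqP; rewrite eq_le mean_sq_le_sqr_fsup ?ltn_ord // andbT sqr_fsup.
apply: ge_sup; first by exists (N 1%N ^+ 2 / 1%:R), 1%N.
by move=> _ [[|m] //= mn <-]; exact: (imax (Ordinal (mn : (m < n.+1)%N))).
Qed.

Lemma fsup_le m n : (0 < m <= n)%N -> fsup N m <= fsup N n.
Proof.
move=> /andP[m0 mn]; rewrite -(@ler_pXn2r _ 2) ?nnegrE ?fsup_ge0 //.
have [k /andP[k0 km] ->] := fsup_attained m0.
by rewrite mean_sq_le_sqr_fsup // k0 (leq_trans km mn).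
Qed.

Lemma le_sqrt_fsup m n :
  (0 < m <= n)%N -> N m <= Num.sqrt m%:R * fsup N n.
Proof.
move=> mn; have m0 : 0 < m%:R :> R by rewrite ltr0n; case/andP: mn.
apply: le_trans (ler_norm _) _.
rewrite -(@ler_pXn2r _ 2) ?nnegrE ?mulr_ge0 ?sqrtr_ge0 ?fsup_ge0 //.
rewrite real_normK ?num_real // exprMn sqr_sqrtr // [leRHS]mulrC -ler_pdivrMr //.
exact: mean_sq_le_sqr_fsup.
Qed.

Lemma fsup_gt0 n : 0 < N 1%N -> (0 < n)%N -> 0 < fsup N n.
Proof.
move=> N1 n0; apply: lt_le_trans N1 _.
by have := @le_sqrt_fsup 1 n n0; rewrite sqrtr1 mul1r.
Qed.

End Fsup.

Section Subadditive.
Variables (R : realType) (N : nat -> R).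
Hypotheses (N_ge0 : forall n, 0 <= N n)
  (N_subadd : forall m n, N (m + n)%N <= N m + N n).

(** After squaring and clearing the denominator, right minus left is x^2 (y - m) + x m y + m^2 y. *)
Lemma sqrt_mul_le (x m y : nat) : (0 < m <= y)%N ->
  Num.sqrt x%:R * Num.sqrt m%:R <=
    (x + m)%:R * Num.sqrt (y%:R / (y + x)%:R) :> R.
Proof.
move=> /andP[m0 my].
have yx0 : 0 < (y + x)%:R :> R by rewrite ltr0n; lia.
rewrite -(@ler_pXn2r _ 2) ?nnegrE ?mulr_ge0 ?sqrtr_ge0 //.
rewrite !exprMn !sqr_sqrtr ?divr_ge0 // mulrA ler_pdivlMr //.
rewrite -natrX -!natrM ler_nat.
have -> : y = (m + (y - m))%N by lia.
nia.
Qed.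

(** The common bound [c] stands for the larger of [fsup N x] and [fsup N y], so that both cases x <=
    y and y <= x are served. *)
Lemma sqr_fsupD_le (x y : nat) (c : R) : (0 < x)%N -> (0 < y)%N ->
  fsup N x <= c -> fsup N y <= c ->
  fsup N (x + y) ^+ 2 <=
    c ^+ 2 + 2 * Num.sqrt (y%:R / (y + x)%:R) * (fsup N x * fsup N y).
Proof.
move=> x0 y0; have [a0 b0] := (fsup_ge0 N x, fsup_ge0 N y).
set s := Num.sqrt _; have s0 : 0 <= s by exact: sqrtr_ge0.
have [|n /andP[n0 nxy] ->] := @fsup_attained _ N (x + y); first by lia.
have [nx|xn] := leqP n x.
  move=> ac _; have := @mean_sq_le_sqr_fsup _ N n x; rewrite n0 nx.
  move=> /(_ isT) /le_trans; apply.
  have : 0 <= s * (fsup N x * fsup N y) by rewrite !mulr_ge0.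
  by move: ac a0; set a := fsup N x; nra.
have {n0 xn nxy} [m mP ->] : exists2 m, (0 < m <= y)%N & n = (x + m)%N.
  by exists (n - x)%N; lia.
have Nx : N x <= Num.sqrt x%:R * fsup N x by rewrite le_sqrt_fsup ?x0 /=.
have Nm := @le_sqrt_fsup _ N m y mP.
have pq := sqrt_mul_le x mP; rewrite -/s in pq.
have xm0 : 0 < (x + m)%:R :> R by rewrite ltr0n; lia.
rewrite ler_pdivrMr // => ac bc.
have {Nx Nm} : N (x + m)%N ^+ 2 <=
    (Num.sqrt x%:R * fsup N x + Num.sqrt m%:R * fsup N y) ^+ 2.
  rewrite ler_pXn2r ?nnegrE ?addr_ge0 ?mulr_ge0 ?sqrtr_ge0 //.
  exact: le_trans (N_subadd x m) (lerD Nx Nm).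
move=> /le_trans; apply.
(* The two squares sum to at most (x + m) c^2; the cross term is controlled by [pq]. *)
rewrite sqrrD !exprMn !(sqr_sqrtr (ler0n _ _)).
have -> : Num.sqrt x%:R * fsup N x * (Num.sqrt m%:R * fsup N y) =
  (Num.sqrt x%:R * Num.sqrt m%:R) * (fsup N x * fsup N y) by ring.
have := ler_wpM2r (mulr_ge0 a0 b0) pq.
have : x%:R * fsup N x ^+ 2 <= x%:R * c ^+ 2.
  by rewrite ler_wpM2l // ler_pXn2r ?nnegrE // (le_trans a0).
have : m%:R * fsup N y ^+ 2 <= m%:R * c ^+ 2.
  by rewrite ler_wpM2l // ler_pXn2r ?nnegrE // (le_trans a0).
by rewrite natrD; lra.
Qed.

(** Common to real and complex scalars: the Hilbert space enters only through properties of [N]. *)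
Lemma Ifun_subadditive_le (x y : nat) : 0 < N 1%N -> (0 < x)%N -> (0 < y)%N ->
  fsup N y ^+ 2 / y%:R <= fsup N x ^+ 2 / x%:R ->
  Ifun (fsup N) x y <= 2 * Num.sqrt (y%:R / (y + x)%:R).
Proof.
move=> N1 x0 y0; rewrite /Ifun.
have [xR yR] : 0 < x%:R :> R /\ 0 < y%:R :> R by rewrite !ltr0n.
have a0 := fsup_gt0 N1 x0; have b0 := fsup_gt0 N1 y0.
have G0 : 0 < fsup N (x + y) by apply: fsup_gt0 => //; lia.
have aG : fsup N x <= fsup N (x + y) by apply: fsup_le; lia.
have bG : fsup N y <= fsup N (x + y) by apply: fsup_le; lia.
have key := @sqr_fsupD_le x y _ x0 y0.
have xy := @fsup_le _ N x y; have yx := @fsup_le _ N y x.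
rewrite ler_pdivrMr // mulrAC ler_pdivlMr // => hyp.
rewrite ler_pdivrMr ?mulr_gt0 //; move: key xy yx; set s := Num.sqrt _.
have s0 : 0 <= s by exact: sqrtr_ge0.
have s2 : s ^+ 2 * (y%:R + x%:R) = y%:R.
  by rewrite sqr_sqrtr ?divr_ge0 // -natrD divfK // pnatr_eq0; lia.
move: a0 b0 G0 aG bG hyp.
set a := fsup N x; set b := fsup N y; set G := fsup N (x + y).
move=> a0 b0 G0 aG bG hyp key xy yx.
have [lexy|/ltnW leyx] := leqP x y.
  have {xy yx} ab : a <= b by apply: xy; rewrite x0.
  have {}lexy : x%:R <= y%:R :> R by rewrite ler_nat.
  have {}key := key b ab (lexx b).
  have s1 : s <= 1 by rewrite -(@ler_pXn2r _ 2) ?nnegrE // expr1n; nra.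
  (* 7/10 is a rational lower bound for sqrt (1/2), and s^2 >= 1/2 because x <= y. *)
  have s7 : 7 / 10 <= s by rewrite -(@ler_pXn2r _ 2) ?nnegrE //; nra.
  have G2 : G <= 2 * b.
    rewrite -(@ler_pXn2r _ 2) ?nnegrE ?ltW ?mulr_gt0 //.
    have : s * (a * b) <= 1 * (b * b).
      by rewrite ler_pM ?mulr_ge0 ?ler_pM // ltW.
    by nra.
  have : 7 / 10 * (G * b) <= s * (G * b) by rewrite ler_wpM2r // mulr_ge0 // ltW.
  (* Expanded, this is G^2 + b^2 <= (5/2) G b, and 5/2 <= 4 * (7/10) <= 4 s. *)
  have : 0 <= (G - b / 2) * (2 * b - G) by rewrite mulr_ge0 //; lra.
  by nra.
have {xy yx} ba : b <= a by apply: yx; rewrite y0.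
have {}leyx : y%:R <= x%:R :> R by rewrite ler_nat.
have {}key := key a (lexx a) ba.
(* Here b^2 x <= a^2 y <= G^2 y, while y = s^2 (x + y) <= 2 s^2 x. *)
have bs : b <= 2 * (s * G).
  rewrite -(@ler_pXn2r _ 2) ?nnegrE ?mulr_ge0 ?(ltW b0) ?(ltW G0) // !exprMn.
  have aG2 : a ^+ 2 <= G ^+ 2 by rewrite ler_pXn2r ?nnegrE ?(ltW a0) ?(ltW G0).
  rewrite -(ler_pM2r xR); apply: le_trans hyp _.
  have : a ^+ 2 * y%:R <= G ^+ 2 * y%:R by rewrite ler_wpM2r.
  have : s ^+ 2 * y%:R <= s ^+ 2 * x%:R by rewrite ler_wpM2l ?sqr_ge0.
  move=> h1 h2; apply: le_trans h2 _.
  have : G ^+ 2 * y%:R <= G ^+ 2 * (2 ^+ 2 * (s ^+ 2 * x%:R)).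
    by rewrite ler_wpM2l ?sqr_ge0 //; lra.
  by lra.
(* Both G^2 - a^2 and b^2 are at most 2 s G b, which adds up to the required 4 s G b. *)
have : b * b <= 2 * (s * G) * b by rewrite ler_wpM2r // ltW.
have : s * (a * b) <= s * (G * b) by rewrite ler_wpM2l // ler_wpM2r // ltW.
by nra.
Qed.

End Subadditive.

Section Stationary.
Variables (K : numFieldType) (theta : K -> K) (H : hilbertType theta).
Variable X : nat -> H.
Hypothesis stX : weakly_stationary X.

(** Both squared norms expand into double sums of inner products, which agree term by term by
    stationarity. *)
Lemma norm_shifted_psum (m n : nat) :
  `|\sum_(1 <= i < n.+1) X (i + m)%N| = `|psum X n|.
Proof.
apply/eqP; rewrite -(@eqrXn2 _ 2) // !sqr_norm_inner /psum; apply/eqP.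
rewrite !linear_sumlz; apply: eq_big_nat => i /andP[i0 _].
rewrite !linear_sumr; apply: eq_big_nat => j /andP[j0 _].
exact: stX.
Qed.

(** Cutting the sum after index m leaves a tail that is a block of length n shifted by m. *)
Lemma norm_psumD (m n : nat) : `|psum X (m + n)| <= `|psum X m| + `|psum X n|.
Proof.
rewrite -(norm_shifted_psum m n); apply: le_trans (ler_normD _ _).
rewrite /psum (@big_cat_nat _ _ _ m.+1) //=; last by rewrite ltnS leq_addr.
by rewrite -{2}(add1n m) big_addn subSn ?leq_addr // addKn.
Qed.

Lemma psum1 : psum X 1 = X 1%N.
Proof. exact: big_nat1. Qed.

End Stationary.

Unset Implicit Arguments.

Theorem proposition8 (R : realType) :
  (forall (H : hilbertType (idfun : R -> R)) (X : nat -> H),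
    weakly_stationary X -> X 1%N <> 0 ->
    let f := fsup (fun n => `|psum X n|) in
    forall x y : nat, (0 < x)%N -> (0 < y)%N ->
      f x ^+ 2 / x%:R >= f y ^+ 2 / y%:R ->
      Ifun f x y <= 2 * Num.sqrt (y%:R / (y + x)%:R))
  /\
  (forall (H : hilbertType (Num.conj : R[i] -> R[i])) (X : nat -> H),
    weakly_stationary X -> X 1%N <> 0 ->
    let f := fsup (fun n => complex.Re `|psum X n|) in
    forall x y : nat, (0 < x)%N -> (0 < y)%N ->
      f x ^+ 2 / x%:R >= f y ^+ 2 / y%:R ->
      Ifun f x y <= 2 * Num.sqrt (y%:R / (y + x)%:R)).
Proof.
split=> H X stX X1 f x y x0 y0; apply: Ifun_subadditive_le => //.
- exact: norm_psumD.
- by rewrite psum1 normr_gt0; apply/eqP.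
(* For complex scalars the norm lies in [R[i]], whose order compares real parts, so each inequality
   passes to [complex.Re]. *)
- by move=> n; have := normr_ge0 (psum X n); rewrite lecE => /andP[].
- move=> m n; have := norm_psumD stX m n.
  by rewrite lecE => /andP[_]; rewrite raddfD.
- have : 0 < `|psum X 1| by rewrite psum1 normr_gt0; apply/eqP.
  by rewrite ltcE => /andP[].
Qed.
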